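(* Let $F$ be a $p$-complete Hausdorff space, let $E$ be a regular $m\tau^*$-Baire Hausdorff space, and let $f:F\to E$ be a nearly continuous mapping with closed graph. Then $f$ is continuous.
   Context: All topological spaces are Hausdorff. $\overline{A}$ denotes closure and $A^\circ$ interior. A mapping $f:F\to E$ is nearly continuous if $f^{-1}(V)\subseteq \left(\overline{f^{-1}(V)}\right)^\circ$ for every open $V\subseteq E$. It has closed graph if $G(f)=\{(x,f(x)):x\in F\}$ is closed in $F\times E$. Webs and $p$-completeness: a pseudo-base of a space $X$ is a family of nonempty open subsets of $X$ such that every nonempty open subset of $X$ contains a member of the family. A web on $F$ is a pair $(T,\phi)$ consisting of a tree $T=(T,\leqslant_T)$ of height $\omega$ and a mapping $\phi$ from $T$ to the nonempty open subsets of $F$ such that: $(w_1)$ $\{\phi(t):t\in T\}$ is a pseudo-base of $F$; $(w_2)$ for every $t\in T$ the set $\{\phi(s): t<_T s\}$ is a pseudo-base of $\phi(t)$. The web is $p$-complete if $\bigcap_{t\in b}\phi(t)\neq\emptyset$ for every cofinal branch $b\subseteq T$ (a branch, i.e. maximal chain, meeting every level $n<\omega$). $F$ is $p$-complete if it admits a $p$-complete web. Tandem Michael game on $E$ (players $\beta'$ and $\alpha'$): Player $\beta'$ starts with a nonempty set $B_1\subseteq E$; $\alpha'$ responds with a nonempty relatively open $A_1\subseteq B_1$ (i.e. $A_1=B_1\cap U$ for some open $U\subseteq E$). Then $\beta'$ chooses a nonempty $B_1'\subseteq E$, and $\alpha'$ responds with a nonempty relatively open $A_1'\subseteq B_1'$.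 Then $\beta'$ chooses a nonempty $B_2\subseteq A_1$, $\alpha'$ responds with a nonempty relatively open $A_2\subseteq B_2$; then $\beta'$ chooses a nonempty $B_2'\subseteq A_1'$, $\alpha'$ responds with a nonempty relatively open $A_2'\subseteq B_2'$; and so on, so that the moves are in the order $B_1,A_1,B_1',A_1',B_2,A_2,B_2',A_2',\dots$ and produce two nested sequences $B_1\supseteq A_1\supseteq B_2\supseteq A_2\supseteq\cdots$ and $B_1'\supseteq A_1'\supseteq B_2'\supseteq A_2'\supseteq\cdots$. Players have full information of the past; a strategy for a player is a map assigning to each finite sequence of preceding moves a legal next move. Player $\alpha'$ wins if $\bigcap_n\overline{A_n}\neq\emptyset$ and $\bigcap_n\overline{A_n'}\neq\emptyset$. Player $\alpha'$ wins strongly if every filter $\mathscr F$ with $A_n\in\mathscr F$ for all $n$ has an accumulation (cluster) point in $\bigcap_n\overline{A_n}\neq\emptyset$, and every filter $\mathscr F'$ with $A_n'\in\mathscr F'$ for all $n$ has an accumulation point in $\bigcap_n\overline{A_n'}\neq\emptyset$. $E$ is $m\tau^*$-Baire if for every strategy of player $\beta'$ there exists a strategy of player $\alpha'$ which wins strongly against it. *)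

(* Defs.v *)
From HB Require Import structures.
From mathcomp Require Import all_boot all_order.
From mathcomp Require Import boolp classical_sets functions cardinality filter.
From mathcomp Require Import topology.

Set Implicit Arguments.
Unset Strict Implicit.
Unset Printing Implicit Defensive.

Local Open Scope classical_set_scope.
Local Open Scope card_scope.
Local Open Scope order_scope.

Definition nearly_continuous (F E : topologicalType) (f : F -> E) : Prop :=
  forall V : set E, open V -> f @^-1` V `<=` interior (closure (f @^-1` V)).

Definition has_closed_graph (F E : topologicalType) (f : F -> E) : Prop :=
  closed (range (fun x => (x, f x)) : set (F * E)).

Definition rel_open (X : topologicalType) (B A : set X) : Prop :=
  exists2 U : set X, open U & A = B `&` U.

(* [Y] carries the subspace topology; [Y = setT] gives pseudo-bases of [X]. *)
Definition pseudo_base (X : topologicalType) (Y : set X)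
    (P : set (set X)) : Prop :=
  (forall A, P A -> A !=set0 /\ rel_open Y A) /\
  (forall V, V !=set0 -> rel_open Y V -> exists2 A, P A & A `<=` V).

Definition is_tree d (T : porderType d) : Prop :=
  forall (t : T) (S : set T), S `<=` [set s | s < t] -> S !=set0 ->
    exists2 m, S m & forall s, S s -> m <= s.

(* In a tree the predecessors of [t] are well-ordered, and a well-order has
   type [n < omega] iff it has exactly [n] elements. *)
Definition tree_level d (T : porderType d) (n : nat) : set T :=
  [set t | [set s | s < t] #= `I_n].
Arguments tree_level {d} T n.

(* Height omega: level omega is empty, and no earlier level is. *)
Definition tree_height_omega d (T : porderType d) : Prop :=
  (forall t : T, exists n, tree_level T n t) /\
  (forall n, tree_level T n !=set0).

Definition branch d (T : porderType d) (b : set T) : Prop :=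
  total_on b <=%O /\
  forall c : set T, total_on c <=%O -> b `<=` c -> c = b.

Definition cofinal_branch d (T : porderType d) (b : set T) : Prop :=
  branch b /\ forall n, b `&` tree_level T n !=set0.

Definition is_web (F : topologicalType) d (T : porderType d)
    (phi : T -> set F) : Prop :=
  [/\ is_tree T, tree_height_omega T,
      forall t, phi t !=set0 /\ open (phi t),
      pseudo_base setT (range phi) &
      forall t, pseudo_base (phi t) (phi @` [set s | t < s])].

Definition p_complete_web (F : topologicalType) d (T : porderType d)
    (phi : T -> set F) : Prop :=
  is_web phi /\
  forall b : set T, cofinal_branch b -> \bigcap_(t in b) phi t !=set0.

Definition p_complete (F : topologicalType) : Prop :=
  exists d (T : porderType d) (phi : T -> set F), p_complete_web phi.

(* A position of the tandem Michael game is the sequence of all moves made so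
   far, in the order B_1, A_1, B'_1, A'_1, B_2, A_2, B'_2, A'_2, ...  Hence
   beta' moves at even and alpha' at odd positions; alpha' answers the previous
   move, while beta', from the second round on, moves inside the answer made
   three moves earlier. *)
Definition legal_move (E : topologicalType) (h : seq (set E)) (M : set E)
    : Prop :=
  M !=set0 /\
  if odd (size h) then rel_open (nth set0 h (size h - 1)) M
  else (4 <= size h)%N -> M `<=` nth set0 h (size h - 3).

Definition legal_position (E : topologicalType) (h : seq (set E)) : Prop :=
  forall k, (k < size h)%N -> legal_move (take k h) (nth set0 h k).

(* Values of a strategy outside the legal positions where its player is to
   move are irrelevant. *)
Definition beta_strategy (E : topologicalType)
    (sigma : seq (set E) -> set E) : Prop :=
  forall h, ~~ odd (size h) -> legal_position h -> legal_move h (sigma h).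

Definition alpha_strategy (E : topologicalType)
    (tau : seq (set E) -> set E) : Prop :=
  forall h, odd (size h) -> legal_position h -> legal_move h (tau h).

Definition next_move (E : topologicalType) (sigma tau : seq (set E) -> set E)
    (h : seq (set E)) : set E :=
  if odd (size h) then tau h else sigma h.

Fixpoint play_prefix (E : topologicalType) (sigma tau : seq (set E) -> set E)
    (n : nat) : seq (set E) :=
  if n is n'.+1 then
    let h := play_prefix sigma tau n' in rcons h (next_move sigma tau h)
  else [::].

Definition play (E : topologicalType) (sigma tau : seq (set E) -> set E)
    (n : nat) : set E :=
  next_move sigma tau (play_prefix sigma tau n).

Definition strongly_winning_seq (E : topologicalType) (A : nat -> set E)
    : Prop :=
  \bigcap_n closure (A n) !=set0 /\
  forall G : set_system E, ProperFilter G -> (forall n, G (A n)) ->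
    exists2 x, (\bigcap_n closure (A n)) x & cluster G x.

(* With rounds indexed from 0, A_n and A'_n are moves number 4n+1 and 4n+3. *)
Definition alpha_wins_strongly (E : topologicalType) (p : nat -> set E)
    : Prop :=
  strongly_winning_seq (fun n => p (4 * n + 1)%N) /\
  strongly_winning_seq (fun n => p (4 * n + 3)%N).

Definition mtau_star_Baire (E : topologicalType) : Prop :=
  forall sigma : seq (set E) -> set E, beta_strategy sigma ->
  exists2 tau : seq (set E) -> set E, alpha_strategy tau &
    alpha_wins_strongly (play sigma tau).

(* Main.v *)
Require Import Defs.
From mathcomp Require Import all_boot all_order.
From mathcomp Require Import boolp classical_sets functions cardinality filter.
From mathcomp Require Import topology.

Import Order.TTheory Order.NatMonotonyTheory.

Set Implicit Arguments.
Unset Strict Implicit.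
Unset Printing Implicit Defensive.

Local Open Scope card_scope.
Local Open Scope order_scope.
Local Open Scope classical_set_scope.

(** Suppose that [f] is discontinuous.  As [E] is regular and [f] nearly
    continuous, there are open sets [V] and [W] with disjoint closures whose
    preimages are both dense in one nonempty open set
    ([discontinuous_oscillation]).  Let beta' play the tandem game on [E] with
    the moves [f @` (f @^-1` P `&` phi t)], where [t] is a node of the web on [F]
    and [P] is an open set, starting from [V] on one side and from [W] on the
    other.  An answer of alpha' cuts [P] down to a smaller open set [P `&` U];
    near continuity then provides a node above [t] on which the preimage of
    [P `&` U] is again dense, while the preimage of the open set on the other
    side, dense on [phi t], stays dense on the smaller set ([state_stepP]).

    The nodes increase, so p-completeness gives a point [x] in all the sets
    [phi t] ([increasing_cofinal_branch]).  On each side, density makes the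
    images of the neighbourhoods of [x], restricted to the sets in play,
    generate a filter that contains all answers of alpha'.  If alpha' wins
    strongly, this filter has a cluster point in the closures of the answers,
    and the closed graph forces it to be [f x] ([closed_graph_cluster]).  Hence
    [f x] is in the closure of [V] and in that of [W]: a contradiction. *)

(** * Plays of the tandem Michael game *)

Lemma size_play_prefix (E : topologicalType) (sigma tau : seq (set E) -> set E)
    n : size (play_prefix sigma tau n) = n.
Proof. by elim: n => //= n IHn; rewrite size_rcons IHn. Qed.

Lemma nth_play_prefix (E : topologicalType) (sigma tau : seq (set E) -> set E)
    n k : (k < n)%N ->
  nth set0 (play_prefix sigma tau n) k = play sigma tau k.
Proof.
elim: n => //= n IHn; rewrite nth_rcons size_play_prefix ltnS leq_eqVlt.
by case/predU1P => [->|kn]; rewrite ?ltnn ?eqxx // kn IHn.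
Qed.

Lemma take_play_prefix (E : topologicalType)
    (sigma tau : seq (set E) -> set E) n k : (k <= n)%N ->
  take k (play_prefix sigma tau n) = play_prefix sigma tau k.
Proof.
elim: n => [|n IHn]; first by case: k.
rewrite leq_eqVlt => /predU1P[->|kn].
  by rewrite -[X in take X _](size_play_prefix sigma tau) take_size.
by rewrite /= -cats1 takel_cat ?size_play_prefix //; exact: IHn.
Qed.

Lemma legal_play (E : topologicalType) (sigma tau : seq (set E) -> set E) n :
    beta_strategy sigma -> alpha_strategy tau ->
  legal_position (play_prefix sigma tau n) /\
  legal_move (play_prefix sigma tau n) (play sigma tau n).
Proof.
move=> bs at_.
have move_legal m : legal_position (play_prefix sigma tau m) ->
    legal_move (play_prefix sigma tau m) (play sigma tau m).
  move=> legm; rewrite /play /next_move.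
  by case: ifPn => [/at_|/bs]; exact.
suff legn : legal_position (play_prefix sigma tau n).
  by split=> //; exact: move_legal.
elim: n => [//|n IHn] k; rewrite size_play_prefix => kn.
rewrite take_play_prefix ?nth_play_prefix //; last exact: ltnW.
apply: move_legal => j; rewrite size_play_prefix => jk.
have jn : (j < n)%N by rewrite (leq_trans jk).
have := IHn j; rewrite size_play_prefix => /(_ jn).
by rewrite !take_play_prefix ?nth_play_prefix // ltnW.
Qed.

(** A strategy has to answer also the legal positions that it would never have
    reached, where an intended move [m h] may be illegal.  There beta' makes the
    largest move that the rules allow. *)
Definition legalize (E : topologicalType) (m : seq (set E) -> set E)
    (h : seq (set E)) : set E :=
  if pselect (legal_move h (m h)) then m h
  else if (4 <= size h)%N then nth set0 h (size h - 3) else setT.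

Lemma legalize_id (E : topologicalType) (m : seq (set E) -> set E) h :
  legal_move h (m h) -> legalize m h = m h.
Proof. by rewrite /legalize; case: pselect. Qed.

Lemma beta_strategy_legalize (E : topologicalType)
    (m : seq (set E) -> set E) : [set: E] !=set0 ->
  beta_strategy (legalize m).
Proof.
move=> E0 h evenh legh; rewrite /legalize; case: pselect => //= _.
rewrite /legal_move (negbTE evenh); case: ifPn => [h4|_] //.
have h3 : (size h - 3 < size h)%N by rewrite ltn_subrL (leq_trans _ h4).
have [nth0 _] := legh _ h3; split=> [//|_]; exact: subset_refl.
Qed.

(** This turns the Baire property into a statement without strategies.  Player
    beta' is described by a transition system: in state [s] the move is [mv s],
    and [R s A s'] says that the answer [A] may lead to the state [s'].  The two
    nested sequences of the game alternate, so the condition that beta' moves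
    inside the last answer on the same side relates states two steps apart. *)
Lemma tandem_run (E : topologicalType) (S : Type) (mv : S -> set E)
    (inv : S -> Prop) (R : S -> set E -> S -> Prop) (s0 : S) :
    mtau_star_Baire E -> inv s0 ->
    (forall s, inv s -> mv s !=set0) ->
    (forall s A, inv s -> A !=set0 -> rel_open (mv s) A ->
      exists2 s', inv s' & R s A s') ->
    (forall s A s' A' s'', R s A s' -> R s' A' s'' -> mv s'' `<=` A) ->
  exists (s : nat -> S) (A : nat -> set E),
    [/\ s 0%N = s0,
        forall n, inv (s n) /\ A n `<=` mv (s n),
        forall n, R (s n) (A n) (s n.+1),
        strongly_winning_seq (fun n => A (2 * n)%N) &
        strongly_winning_seq (fun n => A (2 * n).+1)].
Proof.
move=> baire inv0 mv0 stepP nested.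
have [next nextP] : exists next, forall s A, inv s -> A !=set0 ->
    rel_open (mv s) A -> inv (next s A) /\ R s A (next s A).
  have /choice[g gP] (sA : S * set E) : exists s', inv sA.1 -> sA.2 !=set0 ->
      rel_open (mv sA.1) sA.2 -> inv s' /\ R sA.1 sA.2 s'.
    case: sA => s A /=.
    have [[invs [A0 oA]]|bad] := pselect (inv s /\ A !=set0 /\ rel_open (mv s) A).
      by have [s' ? ?] := stepP s A invs A0 oA; exists s'.
    by exists s => *; exfalso; exact: bad.
  by exists (fun s A => g (s, A)) => s A; exact: (gP (s, A)).
(* the state after [n] answers, the answers being the odd entries of [p] *)
pose st p := fix st n := if n is n'.+1 then next (st n') (p n'.*2.+1) else s0.
pose sigma := legalize (fun h => mv (st (nth set0 h) (size h)./2)).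
have st_ext p q n : (forall k, (k < n.*2)%N -> p k = q k) -> st p n = st q n.
  elim: n => //= n IHn pq; rewrite IHn ?pq // => k kn.
  by apply: pq; rewrite (leq_trans kn) // leq_double.
have bs : beta_strategy sigma.
  apply: beta_strategy_legalize.
  by have [x _] := mv0 _ inv0; exists x.
have [tau at_ [win win']] := baire _ bs.
pose p := play sigma tau; pose s n := st p n; pose A n := p n.*2.+1.
have intended n : let h := play_prefix sigma tau n.*2 in
    mv (st (nth set0 h) (size h)./2) = mv (s n).
  rewrite /= size_play_prefix doubleK; congr mv; apply: st_ext => k kn.
  exact: nth_play_prefix.
have pE n : legal_move (play_prefix sigma tau n.*2) (mv (s n)) ->
    p n.*2 = mv (s n).
  move=> leg; rewrite /p /play /next_move size_play_prefix odd_double.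
  by rewrite -[RHS]intended; apply: legalize_id; rewrite intended.
have answer n : A n !=set0 /\ rel_open (p n.*2) (A n).
  have [_] := legal_play n.*2.+1 bs at_.
  by rewrite /legal_move size_play_prefix oddS odd_double subn1 nth_play_prefix.
have run n : [/\ inv (s n), p n.*2 = mv (s n) & inv (s n.+1) /\
    R (s n) (A n) (s n.+1)].
  elim/ltn_ind: n => -[|n] IHn.
    have p0 : p 0%N = mv s0 by apply: (pE 0%N); split=> [|/=]; [exact: mv0|].
    split=> //; have [A0 oA] := answer 0%N.
    by apply: nextP => //; rewrite -[mv _]p0.
  have [invn _ [invSn Rn]] := IHn _ (ltnSn n).
  have pSn : p n.+1.*2 = mv (s n.+1).
    apply: pE; split; first exact: mv0.
    rewrite size_play_prefix odd_double.
    (* beta' moves inside the answer given three moves, or two states, ago *)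
    case: n IHn invn invSn Rn => // n IHn _ _ Rn _.
    have [_ _ [_ Rn']] := IHn n (leqnSn _).
    have -> : (n.+2.*2 - 3)%N = n.*2.+1 by rewrite !doubleS subSS subn2.
    rewrite nth_play_prefix; first exact: nested Rn' Rn.
    by rewrite !doubleS !ltnS; exact: leqW.
  split=> //; have [A0 oA] := answer n.+1.
  by apply: nextP => //; rewrite -pSn.
exists s, A; split.
- by [].
- move=> n; have [invn <- _] := run n; split=> //.
  by have [_ [U _ ->]] := answer n; exact: subIsetl.
- by move=> n; have [_ _ []] := run n.
- suff -> : (fun n => A (2 * n)%N) = (fun n => p (4 * n + 1)%N) by [].
  by apply/funext => n; rewrite /A -muln2 mulnC mulnA addn1.
- suff -> : (fun n => A (2 * n).+1) = (fun n => p (4 * n + 3)%N) by [].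
  by apply/funext => n; rewrite /A doubleS -muln2 mulnC mulnA addn3.
Qed.

(** * Cofinal branches of trees of height omega *)

Lemma tree_down_total d (T : porderType d) (t : T) : is_tree T ->
  total_on [set s | s <= t] <=%O.
Proof.
move=> treeT r s; rewrite /= !le_eqVlt => /predU1P[->|rt] /predU1P[->|st].
- by rewrite eqxx; left.
- by rewrite st orbT; right.
- by rewrite rt orbT; left.
rewrite -!le_eqVlt.
have [|_ [->|->] min] := treeT t [set r; s] _ (ex_intro _ r (or_introl erefl)).
- by move=> _ [->|->].
- by left; apply: min; right.
- by right; apply: min; left.
Qed.

(** Here height omega enters: every point has finitely many predecessors, while
    a strictly increasing sequence has infinitely many terms. *)
Lemma increasing_unbounded d (T : porderType d) (t : nat -> T) (y : T) :
    tree_height_omega T -> (forall n, t n < t n.+1) ->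
  ~ (forall n, t n < y).
Proof.
move=> [finT _] /incnP/inc_inj t_inj ty; have [n leveln] := finT y.
apply: infinite_nat; rewrite -(eq_finite_set (inj_card_eq (in2W t_inj))).
have fin_y : finite_set [set s | s < y] by exists n.
by apply: sub_finite_set fin_y => _ [m _ <-]; exact: ty.
Qed.

(** The downward closure of an increasing sequence is maximal because nothing
    lies above the whole sequence.  It skips no level: as it is closed downwards
    and well-ordered, each of its elements has an immediate successor in it,
    which lies one level higher. *)
Lemma increasing_cofinal_branch d (T : porderType d) (t : nat -> T) :
    is_tree T -> tree_height_omega T -> (forall n, t n < t n.+1) ->
  cofinal_branch [set s | exists n, s <= t n].
Proof.
move=> treeT heightT t_incr.
have t_mono m n : (m <= n)%N -> t m <= t n by rewrite (incnP t_incr).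
set b := [set s | _].
have b_lt s : b s -> exists n, s < t n.
  by move=> [n sn]; exists n.+1; exact: le_lt_trans sn _.
have b_total : total_on b <=%O.
  move=> r s [m rm] [n sn]; apply: (tree_down_total treeT (t := t (maxn m n))).
    by apply: le_trans rm _; apply: t_mono; exact: leq_maxl.
  by apply: le_trans sn _; apply: t_mono; exact: leq_maxr.
split.
  split=> // c c_total bc; apply/seteqP; split=> // y cy; apply: contrapT => nby.
  apply: (increasing_unbounded (y := y) heightT t_incr) => n.
  apply: lt_le_trans (t_incr n) _.
  have [//|yt] := c_total (t n.+1) y (bc _ (ex_intro _ n.+1 (lexx _))) cy.
  by case: nby; exists n.+1.
elim=> [|n [s [bs]]].
  have [//||m m0 min] := treeT (t 1%N) [set s | s < t 1%N].
    by exists (t 0%N); exact: t_incr.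
  exists m; split; first by exists 1%N; exact: ltW.
  rewrite /tree_level /= II0 card_eq0; apply/eqP/seteqP; split=> // r /= rm.
  by have := lt_le_trans rm (min _ (lt_trans rm m0)); rewrite ltxx.
rewrite /tree_level /= => level_s; have [k sk] := b_lt s bs.
have [r /andP[]//||m /andP[sm mk] min] :=
  treeT (t k.+1) [set r | s < r <= t k].
- by move=> _ /le_lt_trans; exact.
- by exists (t k); rewrite /= sk lexx.
exists m; split; first by exists k.
apply/eq_cardSP; exists s => //.
suff -> : [set r | r < m] `\ s = [set r | r < s] by [].
apply/seteqP; split=> r /= => [[rm rs]|rs]; last first.
  by split=> [|rsE]; [exact: lt_trans sm|rewrite rsE ltxx in rs].
rewrite lt_neqAle; apply/andP; split; first exact/eqP.
have rk : r <= t k := le_trans (ltW rm) mk.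
have [//|sr] := b_total r s (ex_intro _ k rk) bs.
have /min : s < r <= t k.
  by rewrite rk andbT lt_neqAle sr andbT eq_sym; exact/eqP.
by move=> /(lt_le_trans rm); rewrite ltxx.
Qed.

(** * Cluster points and closed graphs *)

(** The filter generated by the images of the traces on [O n] of the
    neighbourhoods of [x] contains every [A n], hence has a cluster point [y].
    Every neighbourhood of [y] meets the image of every neighbourhood of [x]:
    so [(x, y)] is in the closure of the graph, and [y] is [f x]. *)
Lemma closed_graph_cluster (F E : topologicalType) (f : F -> E) (x : F)
    (O : nat -> set F) (A : nat -> set E) :
    has_closed_graph f -> strongly_winning_seq A ->
    (forall n, O n.+1 `<=` O n) -> (forall n, closure (O n) x) ->
    (forall n, f @` O n `<=` A n) ->
  (\bigcap_n closure (A n)) (f x).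
Proof.
move=> cgf [_ clusterA] O_decr xO fO.
have O_mono m n : (m <= n)%N -> O n `<=` O m.
  move=> mn; rewrite -(subnKC mn); elim: (n - m)%N => [|k IHk].
    by rewrite addn0.
  by rewrite addnS => z /O_decr /IHk.
pose G : set_system E :=
  [set S | exists N n, nbhs x N /\ f @` (O n `&` N) `<=` S].
have G_proper : ProperFilter G.
  apply: Build_ProperFilter_ex => [S [N [n [xN sub]]]|].
    by have [z ONz] := xO n N xN; exists (f z); apply: sub; exists z.
  split.
  - by exists setT, 0%N; split; first exact: filterT.
  - move=> S S' [N [n [xN sub]]] [N' [n' [xN' sub']]].
    exists (N `&` N'), (maxn n n'); split; first exact: filterI.
    move=> _ [z [Oz [Nz N'z]] <-]; split.
      by apply: sub; exists z => //; split=> //; apply: O_mono Oz; exact: leq_maxl.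
    by apply: sub'; exists z => //; split=> //; apply: O_mono Oz; exact: leq_maxr.
  - move=> S S' SS' [N [n [xN sub]]]; exists N, n; split=> //.
    exact: subset_trans SS'.
have GA n : G (A n).
  exists setT, n; split; first exact: filterT.
  by rewrite setIT; exact: fO.
have [y Ay Gy] := clusterA G G_proper GA.
suff [z _ [zx zy]] : range (fun z => (z, f z)) (x, y) by rewrite -zx zy.
apply: cgf => B [[N M] /= [xN yM] NMB].
have [|_ [[z [_ Nz] <-] Mz]] := Gy (f @` (O 0%N `&` N)) M _ yM.
  by exists N, 0%N; split.
by exists (z, f z); split; [exists z|exact: NMB].
Qed.

(** * Nearly continuous maps *)

Lemma rel_openI (X : topologicalType) (B U : set X) :
  open U -> rel_open B (B `&` U).
Proof. by move=> oU; exists U. Qed.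

(** At a point [x] of discontinuity, some neighbourhood [N] of [f x] is missed
    by values [f y] with [y] arbitrarily close to [x].  Regularity separates
    [f y] and [f x] by open sets [W] and [V] with disjoint closures, and near
    continuity at [x] and at [y] puts [y] in the interior of the closures of
    both preimages. *)
Lemma discontinuous_oscillation (F E : topologicalType) (f : F -> E) :
    regular_space E -> nearly_continuous f -> ~ continuous f ->
  exists V W : set E, [/\ open V, open W,
    closure V `&` closure W = set0 &
    interior (closure (f @^-1` V) `&` closure (f @^-1` W)) !=set0].
Proof.
move=> regE ncf /existsNP[x /existsNP[N /not_implyP[fxN nxN]]].
have [M fxM MN] := regE _ _ fxN.
have xU : interior (closure (f @^-1` M°)) x.
  by apply: ncf; [exact: open_interior|exact: nbhs_singleton (nbhs_interior fxM)].
have [y Uy nNy] : exists2 y, interior (closure (f @^-1` M°)) y & ~ N (f y).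
  apply: contrapT => noy; apply: nxN; apply: filterS (nbhs_interior xU) => y Uy.
  by apply: contrapT => nNy; apply: noy; exists y.
have [|M' fyM' M'M] := regE (f y) (~` closure M).
  apply: open_nbhs_nbhs; split; last by move/MN.
  by apply: closed_openC; exact: closed_closure.
exists M°, M'°; split; [exact: open_interior|exact: open_interior| |].
  apply/seteqP; split=> // z [/(closureS (@interior_subset _ M)) Mz].
  by move/(closureS (@interior_subset _ M'))/M'M; exact.
exists y; rewrite interiorI; split=> //; apply: ncf; first exact: open_interior.
exact: nbhs_singleton (nbhs_interior fyM').
Qed.

(** * The strategy of beta' *)

(** A state of player beta' in the tandem game: the node of the web reached so
    far, the open set that controls the side on which beta' moves next, and the
    one that controls the other side. *)
Record state (T E : Type) := State { node : T; cur : set E; oth : set E }.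

Definition state_inv (F E : topologicalType) (f : F -> E) (T : Type)
    (phi : T -> set F) (s : state T E) : Prop :=
  [/\ open (cur s), open (oth s),
      phi (node s) `<=` closure (f @^-1` cur s) &
      phi (node s) `<=` closure (f @^-1` oth s)].

Definition state_move (F E : topologicalType) (f : F -> E) (T : Type)
    (phi : T -> set F) (s : state T E) : set E :=
  f @` (f @^-1` cur s `&` phi (node s)).

(** The two sides are exchanged, so that one description serves both of them:
    the set [oth s'] is the one that results from the answer [A]. *)
Definition state_step (F E : topologicalType) (f : F -> E) d
    (T : porderType d) (phi : T -> set F) (s : state T E) (A : set E)
    (s' : state T E) : Prop :=
  [/\ node s < node s', phi (node s') `<=` phi (node s), cur s' = oth s,
      oth s' `<=` cur s & f @` (f @^-1` oth s' `&` phi (node s')) `<=` A].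

Lemma state_move_neq0 (F E : topologicalType) (f : F -> E) (T : Type)
    (phi : T -> set F) (s : state T E) :
    (forall t, phi t !=set0 /\ open (phi t)) -> state_inv f phi s ->
  state_move f phi s !=set0.
Proof.
move=> phiP [_ _ denseP _]; have [[x phix] ophi] := phiP (node s).
have [|y [Py phiy]] := denseP x phix (phi (node s)).
  exact: open_nbhs_nbhs.
by exists (f y), y.
Qed.

(** The answer is [A = state_move s `&` U] for an open [U], and a point of it is
    [f z] with [z] in [f @^-1` (cur s `&` U)].  Near continuity makes this
    preimage dense around [z], so the web has a node above [node s] on which
    it is dense. *)
Lemma state_stepP (F E : topologicalType) (f : F -> E) d
    (T : porderType d) (phi : T -> set F) (s : state T E) (A : set E) :
    nearly_continuous f -> is_web phi -> state_inv f phi s -> A !=set0 ->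
    rel_open (state_move f phi s) A ->
  exists2 s', state_inv f phi s' & state_step f phi s A s'.
Proof.
move=> ncf [_ _ _ _ webP] [oP oQ denseP denseQ] A0 [U oU AE].
move: A0; rewrite AE => -[_ [[z [Pz phiz] <-] Uz]].
have oPU : open (cur s `&` U) by exact: openI.
have [_ base_sub] := webP (node s).
have [||_ [t st <-] phit] :=
  base_sub (phi (node s) `&` interior (closure (f @^-1` (cur s `&` U)))).
- by exists z; split=> //; exact: ncf oPU z (conj Pz Uz).
- by apply: rel_openI; exact: open_interior.
have t_sub : phi t `<=` phi (node s) by move=> x /phit[].
exists (State t (oth s) (cur s `&` U)); split=> //=.
- by move=> x /t_sub /denseQ.
- by move=> x /phit[_ /interior_subset].
- by move=> _ [x [[Px Ux] /t_sub phix] <-]; split=> //; exists x.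
Qed.

Theorem theorem2 (F E : topologicalType) (f : F -> E)
  (hausF : hausdorff_space F) (pcF : p_complete F)
  (hausE : hausdorff_space E) (regE : regular_space E)
  (baireE : mtau_star_Baire E)
  (ncf : nearly_continuous f) (cgf : has_closed_graph f) :
  continuous f.
Proof.
have [d [T [phi [web complete]]]] := pcF.
have [treeT heightT phiP [_ base_sub] _] := web.
apply: contrapT => /(discontinuous_oscillation regE ncf).
move=> [V [W [oV oW VW0 osc0]]].
have [|_ [t0 _ <-] t0_sub] := base_sub _ osc0.
  by rewrite -[interior _]setTI; apply: rel_openI; exact: open_interior.
pose s0 := State t0 V W.
have inv0 : state_inv f phi s0.
  by split=> // x /t0_sub /interior_subset[].
have nested s A s' A' s'' : state_step f phi s A s' ->
    state_step f phi s' A' s'' -> state_move f phi s'' `<=` A.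
  move=> [_ _ _ _ sub] [_ phi_sub curE _ _]; apply: subset_trans sub.
  by rewrite /state_move curE => _ [x [Qx phix] <-]; exists x => //; split; auto.
have [s [A [s0E sP stepP win win']]] := tandem_run baireE inv0
  (fun s => @state_move_neq0 _ _ f _ phi s phiP)
  (fun s A => @state_stepP _ _ f _ _ phi s A ncf web) nested.
have [x xP] : \bigcap_(t in [set t | exists n, t <= node (s n)]) phi t !=set0.
  apply: complete; apply: increasing_cofinal_branch => // n.
  by have [] := stepP n.
have phix n : phi (node (s n)) x by apply: xP; exists n.
(* the traces in [F] of the open sets obtained after the answer [A n] *)
pose O n := f @^-1` oth (s n.+1) `&` phi (node (s n.+1)).
have O_decr n : O n.+2 `<=` O n.
  have [_ sub1 _ _ _] := stepP n.+1; have [_ sub2 _ oth_sub _] := stepP n.+2.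
  have [_ _ curE _ _] := stepP n.+1.
  move=> z [/oth_sub]; rewrite curE => Qz /sub2 /sub1; by split.
have xO n : closure (O n) x.
  move=> N xN; have [[_ _ _ dense] _] := sP n.+1.
  have [|z [Qz [Nz phiz]]] := dense x (phix _) (N `&` phi (node (s n.+1))).
    apply: filterI => //; apply: open_nbhs_nbhs; split=> //.
    by have [] := phiP (node (s n.+1)).
  by exists z.
have OA n : f @` O n `<=` A n by have [] := stepP n.
(* [i = 0] is the side that starts in [V], and [i = 1] the one in [W] *)
have side i S : strongly_winning_seq (fun n => A (i + 2 * n)%N) ->
    cur (s i) `<=` S -> closure S (f x).
  move=> wini curS.
  have := closed_graph_cluster (x := x) (O := fun n => O (i + 2 * n)%N) cgf wini.
  move=> /(_ _ (fun n => xO _) (fun n => OA _)) cl.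
  have /cl/(_ 0%N I) : forall n, O (i + 2 * n.+1)%N `<=` O (i + 2 * n)%N.
    by move=> n; rewrite mulnS addnCA; exact: O_decr.
  rewrite muln0 addn0; apply: closureS.
  have [_ AS] := sP i; apply: (subset_trans AS).
  by move=> _ [z [/curS ? _] <-].
have clV : closure V (f x) by apply: (side 0%N) => //; rewrite s0E.
have clW : closure W (f x).
  by apply: (side 1%N) => //; have [_ _ -> _ _] := stepP 0%N; rewrite s0E.
by rewrite -[False]/(set0 (f x)) -VW0.
Qed.
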